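(* Let $(X,d)$ be a compact metric space supporting a $g$-Ahlfors regular measure $\mathcal H^g$, where $g$ is a doubling dimension function. Let $f$ be a dimension function such that $f\preceq g$. Then the class $\mathscr G^f(X)$ is closed under countable intersections. Moreover, for every $A\in\mathscr G^f(X)$ we have $\mathcal H^f(A)=\mathcal H^f(X)$.
   Context: A dimension function is a continuous nondecreasing $f:\mathbb R^+\to\mathbb R^+$ with $f(0)=0$; it is doubling if there is $D>1$ with $f(2r)<Df(r)$ for all $r>0$. For $A\subset X$ and $0<\eta\le\infty$, $\mathcal H^f_\eta(A)=\inf\{\sum_i f(|B_i|): A\subset\bigcup_i B_i,\ B_i \text{ balls with } |B_i|\le\eta\}$ ($|\cdot|$ = diameter); $\mathcal H^f(A)=\lim_{\eta\to0}\mathcal H^f_\eta(A)$ is the Hausdorff $f$-measure and $\mathcal H^f_\infty(A)$ is the Hausdorff $f$-content. $\mathcal H^g$ is $g$-Ahlfors regular if $\mathcal H^g(B(x,r))\asymp g(r)$ for all $x\in X$, $r>0$. For dimension functions $h,f$, $h\preceq f$ means $r\mapsto h(r)/f(r)$ is monotonic and $\lim_{r\to0}h(r)/f(r)>0$ (possibly infinite). $\mathscr G^f(X)$ is the class of $G_\delta$-subsets $A\subset X$ for which there is a constant $c>0$ such that $\mathcal H^f_\infty(A\cap B)>c\,\mathcal H^f_\infty(B)$ for every ball $B\subset X$. *)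

(* Defs.v *)
From HB Require Import structures.
From mathcomp Require Import all_boot all_order all_algebra.
From mathcomp Require Import all_classical all_reals all_analysis.
From mathcomp Require Import borel_hierarchy.

Set Implicit Arguments.
Unset Strict Implicit.
Unset Printing Implicit Defensive.

Import Order.TTheory GRing.Theory Num.Theory.
Import numFieldNormedType.Exports.

Local Open Scope classical_set_scope.
Local Open Scope ring_scope.

(* Functions on R^+ = [0, +oo[ are represented by functions on R whose values
   at negative arguments are never used. *)
Definition dimension_function (R : realType) (f : R -> R) : Prop :=
  [/\ {within `[0, +oo[, continuous f},
      {in `[0, +oo[ &, {homo f : r s / r <= s}},
      (forall r, 0 <= r -> 0 <= f r) &
      f 0 = 0].

Definition doubling (R : realType) (f : R -> R) : Prop :=
  exists2 D : R, 1 < D & forall r, 0 < r -> f (2 * r) < D * f r.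

(* Real-valued diameter: [sup] is 0 on the empty set and on unbounded sets, but
   it is only applied to balls of positive radius, which are nonempty and
   bounded. *)
Definition diam (R : realType) (X : metricType R) (A : set X) : R :=
  sup [set mdist p.1 p.2 | p in A `*` A].

(* A countable (finite or infinite) cover of A by open balls of diameter at
   most eta: ball i is [ball (x i) (r i)], for the indices i in D only. *)
Definition ball_cover (R : realType) (X : metricType R) (eta : \bar R)
    (A : set X) (D : set nat) (x : nat -> X) (r : nat -> R) : Prop :=
  (forall i, D i -> 0 < r i /\ ((diam (ball (x i) (r i)))%:E <= eta)%E) /\
  A `<=` \bigcup_(i in D) ball (x i) (r i).

Definition hausdorff_content_eta (R : realType) (X : metricType R)
    (f : R -> R) (eta : \bar R) (A : set X) : \bar R :=
  ereal_inf [set s | exists D x r, ball_cover eta A D x r /\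
    s = \esum_(i in D) (f (diam (ball (x i) (r i))))%:E].

Definition hausdorff_content (R : realType) (X : metricType R)
    (f : R -> R) (A : set X) : \bar R :=
  hausdorff_content_eta f +oo%E A.

Definition hausdorff_measure (R : realType) (X : metricType R)
    (f : R -> R) (A : set X) : \bar R :=
  lim (hausdorff_content_eta f eta%:E A @[eta --> 0^'+]).

Definition ahlfors_regular (R : realType) (X : metricType R) (g : R -> R) :
    Prop :=
  exists2 C : R, 0 < C & forall (x : X) (r : R), 0 < r ->
    ((C^-1 * g r)%:E <= hausdorff_measure g (ball x r))%E /\
    (hausdorff_measure g (ball x r) <= (C * g r)%:E)%E.

Definition monotonic_on_pos (R : realType) (u : R -> R) : Prop :=
  {in `]0, +oo[ &, {homo u : r s / r <= s}} \/
  {in `]0, +oo[ &, {homo u : r s / r <= s >-> s <= r}}.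

(* [dim_prec h f] is the relation h \preceq f.  The limit of h/f at 0 may be
   +oo, hence is taken in the extended reals. *)
Definition dim_prec (R : realType) (h f : R -> R) : Prop :=
  monotonic_on_pos (fun r => h r / f r) /\
  exists2 l : \bar R, (0 < l)%E & (h r / f r)%:E @[r --> 0^'+] --> l.

Definition large_intersection_class (R : realType) (X : metricType R)
    (f : R -> R) : set (set X) :=
  [set A | Gdelta A /\
    exists2 c : R, 0 < c & forall (x : X) (r : R), 0 < r ->
      (c%:E * hausdorff_content f (ball x r)
        < hausdorff_content f (A `&` ball x r))%E].

(* Main.v *)
(* Since f / g is almost decreasing near 0, f is doubling and a ball of radius r
   has f-content comparable to f(r).
   Intersections: suppose balls B_i with small total f-cost cover the
   intersection of the open sets U_n inside a ball.  In a ball that meets only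
   smaller B_i of small total cost, the content of U_n exceeds that of the union
   of the 4 B_i, and at almost every point outside this union the cost of the
   B_i near the point is negligible with respect to f(rho) along some scales
   rho -> 0.  Hence the ball contains a much smaller one, inside U_n, with the
   same property, where the threshold on the cost may be adapted to the constant
   of the next open set.  The nested balls meet in a point of all the U_n that no
   B_i covers.  The constant obtained depends only on f, g and X, because only
   the content of balls enters the choice of the first ball.
   Measure: if f / g is unbounded, a separated net of balls of radius r gives
   H^f(A) >= const * f(r) / g(r).  Otherwise H^f(X) is finite; if an open V
   contains A, then every ball centred at a point outside V carries a definite
   part of f(r) inside V close to the complement of V, where H^f is small, so
   the complement of V is H^f-null. *)

Require Import Defs.
From HB Require Import structures.
From mathcomp Require Import all_boot all_order all_algebra.
From mathcomp Require Import all_classical all_reals all_analysis.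
From mathcomp Require Import borel_hierarchy.
From mathcomp Require Import ring lra.

Set Implicit Arguments.
Unset Strict Implicit.
Unset Printing Implicit Defensive.

Import Order.TTheory GRing.Theory Num.Theory.
Import numFieldNormedType.Exports.

Local Open Scope classical_set_scope.
Local Open Scope ring_scope.

(** * Sums and outer measures generated by balls *)

Section esum_extra.
Context {R : realType} {T : choiceType}.
Implicit Types (A B C : set T) (a : T -> \bar R).
Local Open Scope ereal_scope.

Lemma esum_subset A B a : (forall i, 0 <= a i) -> A `<=` B ->
  \esum_(i in A) a i <= \esum_(i in B) a i.
Proof.
move=> a0 AB; rewrite (esumID A B)// setIidr//.
by apply: leeDl; apply: esum_ge0.
Qed.

Lemma esum_ge_term A a t : (forall i, 0 <= a i) -> A t -> a t <= \esum_(i in A) a i.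
Proof.
by move=> a0 At; rewrite -(@esum_set1 _ _ t a)//; apply: esum_subset => // _ ->.
Qed.

Lemma sum_esum_le (I : eqType) (e : rel I) (P : seq I) (E : I -> set T) C a :
  (forall i, 0 <= a i) ->
  (forall p q, e p q -> [disjoint E p & E q]%classic) ->
  pairwise e P -> (forall p, p \in P -> E p `<=` C) ->
  \sum_(p <- P) \esum_(i in E p) a i <= \esum_(i in C) a i.
Proof.
move=> a0 eE; elim: P C => [|p P IH] C /=.
  by move=> _ _; rewrite big_nil esum_ge0.
move=> /andP[/allP pP PP] EC; rewrite big_cons (esumID (E p) C)//.
rewrite setIidr; last by apply: EC; rewrite mem_head.
apply: leeD => //; apply: IH => // q qP i Eqi; split.
  by apply: (EC q) => //; rewrite inE qP orbT.
move=> Epi; have /disj_setPS/(_ i) := eE _ _ (pP _ qP).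
exact.
Qed.

Lemma esum_scale_le A a (k : R) : (forall i, 0 <= a i) -> (0 <= k)%R ->
  \esum_(i in A) (k%:E * a i) <= k%:E * \esum_(i in A) a i.
Proof.
move=> a0 k0; apply: ge_ereal_sup => _ [F FA <-].
rewrite -ge0_mule_fsumr//; apply: lee_wpmul2l; rewrite ?lee_fin//.
by apply: ereal_sup_ubound; exists F.
Qed.

End esum_extra.

Lemma esum_tail_lt (R : realType) (D : set nat) (a : nat -> \bar R) (e : R) :
  (forall i, 0 <= a i)%E -> (\esum_(i in D) a i < +oo)%E -> 0 < e ->
  exists N, (\esum_(i in D `&` [set i | (N <= i)%N]) a i < e%:E)%E.
Proof.
move=> a0 Doo e0; pose P : pred nat := mem D.
have := @nneseries_tail_cvg R a P.
rewrite nneseries_esum// (_ : [set x | P x] = D); last first.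
  by apply/seteqP; split => i; rewrite /P /= in_setE.
move=> /(_ Doo (fun k _ => a0 k)) /fine_cvgP[fin cv].
have /cvgrPdist_lt/(_ e e0) [N _ HN] := cv.
have [N' _ HN'] := fin.
exists (maxn N N'); have := HN _ (leq_maxl N N'); have := HN' _ (leq_maxr N N').
rewrite /= sub0r normrN; set s := (\sum_(_ <= _ <oo | _) _)%E.
have -> : (\esum_(i in D `&` [set i | (maxn N N' <= i)%N]) a i)%E = s.
  rewrite /s eseries_cond nneseries_esum//; congr (esum _ _).
  by apply/seteqP; split => i; rewrite /P /= andbC;
    [move=> [Di ->]; rewrite mem_set | move=> /andP[-> /set_mem]].
move=> fs /(le_lt_trans (ler_norm _)) se; rewrite -(fineK fs).
by rewrite lte_fin.
Qed.

Section ball_content.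
Context {R : realType} {X : metricType R}.
Implicit Types (phi : X -> R -> \bar R) (E : set X).
Local Open Scope ereal_scope.

(* Outer measure generated by the cost [phi x r] of the ball B(x, r); balls of
   infinite cost are thereby excluded from covers. *)
Definition ball_content phi E : \bar R :=
  ereal_inf [set s | exists (D : set nat) (x : nat -> X) (r : nat -> R),
    [/\ forall i, D i -> (0 < r i)%R, E `<=` \bigcup_(i in D) ball (x i) (r i)
      & s = \esum_(i in D) phi (x i) (r i)]].

Variables (phi : X -> R -> \bar R) (phi0 : forall x r, 0 <= phi x r).

Lemma ball_content_ge0 E : 0 <= ball_content phi E.
Proof.
by apply/ereal_infP => _ [D [x [r [_ _ ->]]]]; apply: esum_ge0.
Qed.

Lemma ball_content_cover (D : set nat) (x : nat -> X) (r : nat -> R) E :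
  (forall i, D i -> (0 < r i)%R) -> E `<=` \bigcup_(i in D) ball (x i) (r i) ->
  ball_content phi E <= \esum_(i in D) phi (x i) (r i).
Proof. by move=> r0 ED; apply: ereal_inf_lbound; exists D, x, r. Qed.

Lemma ball_content_lt E t : ball_content phi E < t ->
  exists (D : set nat) (x : nat -> X) (r : nat -> R),
    [/\ forall i, D i -> (0 < r i)%R, E `<=` \bigcup_(i in D) ball (x i) (r i)
      & \esum_(i in D) phi (x i) (r i) < t].
Proof. by move=> /ereal_inf_lt[_ [D [x [r [? ? ->]]]] ?]; exists D, x, r. Qed.

Lemma le_ball_content E F : E `<=` F -> ball_content phi E <= ball_content phi F.
Proof.
move=> EF; apply/ereal_infP => _ [D [x [r [r0 FD ->]]]].
by apply: ball_content_cover => //; apply: subset_trans FD.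
Qed.

Lemma ball_content_set0 (x0 : X) : ball_content phi set0 = 0.
Proof.
apply/eqP; rewrite eq_le ball_content_ge0 andbT.
rewrite -(esum_set0 (fun i : nat => phi x0 1%R)).
by apply: (@ball_content_cover set0 (fun=> x0) (fun=> 1%R)).
Qed.

Lemma ball_content_ball (x : X) (r : R) E : (0 < r)%R -> E `<=` ball x r ->
  ball_content phi E <= phi x r.
Proof.
move=> r0 EB; rewrite -(@esum_set1 _ _ 0%N (fun i => phi x r))//.
by apply: ball_content_cover => // y /EB; exists 0%N.
Qed.

(** Near-optimal covers of the sets [G n], with errors [e / 2 ^ n.+1] of sum at most [e], are merged
    into one cover indexed by the codes of pairs. *)
Lemma ball_content_sigma_subadditive (G : nat -> set X) E :
  E `<=` \bigcup_n G n -> ball_content phi E <= \sum_(n <oo) ball_content phi (G n).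
Proof.
move=> EG; have [Goo|] := ltP (\sum_(n <oo) ball_content phi (G n)) +oo; last first.
  by rewrite leye_eq => /eqP ->; rewrite leey.
apply/lee_addgt0Pr => e e0.
apply: le_trans (epsilon_trick _ _ (ltW e0)); last by move=> n; exact: ball_content_ge0.
have Gfin n : ball_content phi (G n) \is a fin_num.
  rewrite ge0_fin_numE ?ball_content_ge0//; apply: le_lt_trans Goo.
  rewrite (@nneseriesD1 _ _ n)//; last by move=> *; exact: ball_content_ge0.
  by apply: leeDl; apply: nneseries_ge0 => *; exact: ball_content_ge0.
have h n : exists q : set nat * (nat -> X) * (nat -> R),
    [/\ forall i, q.1.1 i -> (0 < q.2 i)%R,
      G n `<=` \bigcup_(i in q.1.1) ball (q.1.2 i) (q.2 i) &
      \esum_(i in q.1.1) phi (q.1.2 i) (q.2 i) <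
        ball_content phi (G n) + (e / (2 ^ n.+1)%:R)%:E].
  have /ball_content_lt[D [x [r ?]]] :
      ball_content phi (G n) < ball_content phi (G n) + (e / (2 ^ n.+1)%:R)%:E.
    by rewrite lteDl// lte_fin divr_gt0// ltr0n expn_gt0.
  by exists (D, x, r).
have [q Hq] := choice h.
pose J := [set: nat] `*`` (fun n => (q n).1.1).
(* The default pair is never seen: the merged cover only uses indices in the image of [pickle]. *)
pose dec (j : nat) : nat * nat := odflt (0%N, 0%N) (unpickle j).
have decK k : dec (pickle k) = k by rewrite /dec pickleK.
pose x j := (q (dec j).1).1.2 (dec j).2; pose r j := (q (dec j).1).2 (dec j).2.
have -> : \sum_(n <oo) (ball_content phi (G n) + (e / (2 ^ n.+1)%:R)%:E) =
    \esum_(n in [set: nat]) (ball_content phi (G n) + (e / (2 ^ n.+1)%:R)%:E).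
  rewrite nneseries_esumT// => n; rewrite adde_ge0// ?ball_content_ge0//.
  by rewrite lee_fin divr_ge0// ltW.
apply: (@le_trans _ _ (\esum_(n in [set: nat])
    \esum_(i in (q n).1.1) phi ((q n).1.2 i) ((q n).2 i))); last first.
  by apply: le_esum => n _; case: (Hq n) => _ _ /ltW.
rewrite esum_esum//.
apply: (@le_trans _ _ (\esum_(j in pickle @` J) phi (x j) (r j))); last first.
  rewrite esum_image; last by move=> ? ? _ _; exact: (pcan_inj pickleK).
  by apply: le_esum => k _; rewrite /x /r decK.
apply: ball_content_cover.
  move=> _ [[n i] [/= _ Di] <-]; rewrite /r decK /=.
  by case: (Hq n) => + _ _; exact.
move=> y /EG[n _ Gy]; case: (Hq n) => _ /(_ y Gy)[i Di Bi] _.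
by exists (pickle (n, i)); [exists (n, i) | rewrite /x /r decK].
Qed.

Lemma ball_contentU (x0 : X) E F G : E `<=` F `|` G ->
  ball_content phi E <= ball_content phi F + ball_content phi G.
Proof.
move=> EFG; pose S n := if n is 0%N then F else if n is 1%N then G else set0.
have /ball_content_sigma_subadditive : E `<=` \bigcup_n S n.
  by move=> y /EFG[Fy|Gy]; [exists 0%N|exists 1%N].
have c0 n : 0 <= ball_content phi (S n) by exact: ball_content_ge0.
rewrite (nneseries_split 0%N 2)// eseries0 ?adde0; last first.
  by move=> [|[|n]]// _ _; rewrite (ball_content_set0 x0).
by rewrite add0n !big_nat_recl//= big_geq// adde0.
Qed.

Lemma ball_content_seq (x0 : X) (I : eqType) (P : seq I) (G : I -> set X) E :
  (forall y, E y -> exists2 p, p \in P & G p y) ->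
  ball_content phi E <= \sum_(p <- P) ball_content phi (G p).
Proof.
elim: P E => [|p P IH] E EP.
  rewrite big_nil -(ball_content_set0 x0); apply: le_ball_content => y /EP[p].
  by rewrite in_nil.
rewrite big_cons; apply: (@le_trans _ _ (ball_content phi (G p) +
    ball_content phi [set y | exists2 p, p \in P & G p y])); last first.
  by rewrite leeD2l// IH.
apply: ball_contentU => // y /EP[p']; rewrite inE => /orP[/eqP ->|p'P Gy].
  by left.
by right; exists p'.
Qed.

(** A ball of finite cost meets at most one of the sets [E p], so a cover of [F] of finite cost
    contains disjoint subfamilies, one covering each [E p]. *)
Lemma ball_content_separated (I : eqType) (e : rel I) (P : seq I)
    (E : I -> set X) F : pairwise e P ->
  (forall p q x r, e p q -> phi x r < +oo -> E p `&` ball x r !=set0 ->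
     E q `&` ball x r !=set0 -> False) ->
  (forall p, p \in P -> E p `<=` F) ->
  \sum_(p <- P) ball_content phi (E p) <= ball_content phi F.
Proof.
move=> eP sep EF; apply/ereal_infP => _ [D [x [r [r0 FD ->]]]].
have [Doo|] := ltP (\esum_(i in D) phi (x i) (r i)) +oo; last first.
  by rewrite leye_eq => /eqP ->; rewrite leey.
pose S p := D `&` [set i | E p `&` ball (x i) (r i) !=set0].
apply: (@le_trans _ _ (\sum_(p <- P) \esum_(i in S p) phi (x i) (r i))).
  rewrite big_seq [leRHS]big_seq; apply: lee_sum => p pP; apply: ball_content_cover.
    by move=> i [/r0].
  move=> y Ey; have [i Di Bi] := FD y (EF p pP y Ey).
  by exists i => //; split => //; exists y.
apply: (sum_esum_le (e := e)) => //.
- move=> p q epq; apply/disj_setPS => i [[Di Epi] [_ Eqi]].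
  apply: (sep p q (x i) (r i)) => //; apply: le_lt_trans Doo.
  by apply: (esum_ge_term (a := fun i => phi (x i) (r i))).
- by move=> p pP i [].
Qed.

End ball_content.

(** Each ball of a cover is replaced by a larger concentric one. This serves to pass between costs
    by radius and by diameter, and from [g] to [f]. *)
Lemma ball_content_le_scale (R : realType) (X : metricType R)
    (phi psi : X -> R -> \bar R) (k : R) (E : set X) :
  (forall x r, 0 <= phi x r)%E -> (forall x r, 0 <= psi x r)%E -> 0 < k ->
  (forall (x : X) (r : R), 0 < r ->
     exists2 r', 0 < r' & ball x r `<=` ball x r' /\
       (phi x r' <= k%:E * psi x r)%E) ->
  (ball_content phi E <= k%:E * ball_content psi E)%E.
Proof.
move=> phi0 psi0 k0 H; rewrite -lee_pdivrMl//; apply/ereal_infP.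
move=> _ [D [x [r [r0 ED ->]]]]; rewrite lee_pdivrMl//.
have h i : exists r', D i -> 0 < r' /\ ball (x i) (r i) `<=` ball (x i) r' /\
       (phi (x i) r' <= k%:E * psi (x i) (r i))%E.
  have [Di|nDi] := pselect (D i); last by exists 0.
  by have [r' ? ?] := H (x i) _ (r0 i Di); exists r'.
have [r' Hr'] := choice h.
apply: (@le_trans _ _ (\esum_(i in D) phi (x i) (r' i))%E).
  apply: ball_content_cover => // [i /Hr'[]//|y /ED[i Di Bi]].
  by exists i => //; have [_ [+ _]] := Hr' i Di; exact.
apply: (@le_trans _ _ (\esum_(i in D) (k%:E * psi (x i) (r i)))%E).
  by apply: le_esum => i /Hr'[_ []].
exact: esum_scale_le (ltW k0).
Qed.

(** * Hausdorff measures on a bounded metric space *)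

Section metric.
Context {R : realType} {X : metricType R}.
Hypothesis X_compact : compact [set: X].

Lemma ball_mdist (x y : X) (r : R) : ball x r y <-> mdist x y < r.
Proof. by rewrite ballEmdist. Qed.

Lemma open_metric_ball (x : X) (r : R) : open (ball x r).
Proof.
rewrite openE => y /ball_mdist xy; apply/nbhs_ballP.
exists (r - mdist x y); first by rewrite /= subr_gt0.
move=> z /ball_mdist yz; apply/ball_mdist.
by have := metric_triangle x y z; lra.
Qed.

Lemma compact_finite_net (s : R) : 0 < s ->
  exists P : seq X, forall y, exists2 p, p \in P & mdist p y < s.
Proof.
(* Finite sequences are ordered by inclusion. A point of the sequence serves a whole neighbourhood,
   and compactness, as a near-covering property along this filter, gives one sequence that serves
   all points. *)
move=> s0; pose F : set_system (seq X) :=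
  filter_from [set: seq X] (fun P0 : seq X => [set P : seq X | {subset P0 <= P}]).
have FF : Filter F.
  apply: filter_from_filter; first by exists [::].
  move=> P Q _ _; exists (P ++ Q) => // S PQS.
  by split=> p pin; apply: PQS; rewrite mem_cat pin ?orbT.
have /compact_near_coveringP : compact [set: X] by [].
move=> /(_ _ F (fun P y => exists2 p, p \in P & mdist p y < s) FF)[].
  move=> x _; exists (ball x s, [set P : seq X | x \in P]).
    split=> /=; first exact: nbhsx_ballx.
    by exists [:: x] => // P; apply; rewrite mem_head.
  by move=> [y P] /= [/ball_mdist xy xP]; exists x.
by move=> P0 _ /(_ P0 (fun _ => id)) H; exists P0 => y; exact: H.
Qed.

Lemma compact_mdist_bounded : exists2 M : R, 0 < M & forall x y : X, mdist x y < M.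
Proof.
have [P HP] := compact_finite_net ltr01.
(* [S] bounds all distances between points of the net; the final 2 accounts for two unit steps from
   the net. *)
pose S := \sum_(p <- P) \sum_(q <- P) mdist p q.
have S_ge0 : 0 <= S by apply: sumr_ge0 => p _; apply: sumr_ge0 => q _; exact: mdist_ge0.
have le_S p q : p \in P -> q \in P -> mdist p q <= S.
  move=> pP qP; rewrite /S (big_rem p)//= (big_rem q)//= -addrA lerDl addr_ge0//.
    by apply: sumr_ge0 => *; exact: mdist_ge0.
  by apply: sumr_ge0 => *; apply: sumr_ge0 => *; exact: mdist_ge0.
exists (S + 2); first by lra.
move=> x y; have [p pP px] := HP x; have [q qP qy] := HP y.
have := le_S _ _ pP qP; have := metric_triangle x p y.
have := metric_triangle p q y; rewrite (metric_sym x p); lra.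
Qed.

(** Greedy choice along a finite [s / 2]-net [C]: for each [c] near [K], one point of [K] near [c]
    is added unless it is within [s] of a point chosen before. A point of [K] is then within [s] of
    such a candidate, itself chosen or within [s] of a chosen point, whence the radius [2 * s]. *)
Lemma separated_net (K : set X) (s : R) : 0 < s ->
  exists P : seq X, [/\ pairwise (fun p q => s <= mdist p q) P,
    forall p, p \in P -> K p &
    forall y, K y -> exists2 p, p \in P & ball p (2 * s) y].
Proof.
move=> s0; have s20 : 0 < s / 2 by lra.
have [C HC] := compact_finite_net s20.
suff [P [sepP PK HP]] : exists P : seq X,
    [/\ pairwise (fun p q => s <= mdist p q) P, forall p, p \in P -> K p &
    forall y c, c \in C -> mdist c y < s / 2 -> K y ->
      exists2 p, p \in P & mdist p y < 2 * s].
  exists P; split=> // y Ky; have [c cC cy] := HC y.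
  by have [p ? ?] := HP y c cC cy Ky; exists p => //; apply/ball_mdist.
elim: C {HC} => [|c C [P [sepP PK HP]]]; first by exists [::]; split.
have [[y0 Ky0 cy0]|no] := pselect (exists2 y, K y & mdist c y < s / 2); last first.
  exists P; split=> // y c'; rewrite inE => /orP[/eqP -> cy Ky|]; last exact: HP.
  by exfalso; apply: no; exists y.
have near y : mdist c y < s / 2 -> mdist y0 y < s.
  move=> cy; have := metric_triangle y0 c y; rewrite (metric_sym y0 c); lra.
have [/allP far|/allPn[p pP]] := boolP (all (fun p => s <= mdist y0 p) P).
  exists (y0 :: P); split => /=.
  - by rewrite sepP andbT; apply/allP.
  - by move=> p; rewrite inE => /orP[/eqP ->|/PK].
  - move=> y c'; rewrite inE => /orP[/eqP -> cy Ky|c'C c'y Ky].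
      by exists y0; [rewrite mem_head | have := near y cy; lra].
    by have [p pP py] := HP y c' c'C c'y Ky; exists p => //; rewrite inE pP orbT.
rewrite -ltNge => y0p; exists P; split => // y c'.
rewrite inE => /orP[/eqP -> cy Ky|]; last exact: HP.
exists p => //; have := metric_triangle p y0 y; have := near y cy.
by rewrite (metric_sym p y0); lra.
Qed.

Variables (M : R) (M_bound : forall x y : X, mdist x y < M).

Lemma mdist_le_diam (A : set X) y z : A y -> A z -> mdist y z <= diam A.
Proof.
move=> Ay Az; apply: ub_le_sup.
  by exists M => _ [p _ <-]; exact: ltW.
by exists (y, z).
Qed.

Lemma diam_le (A : set X) (t : R) : 0 <= t ->
  (forall y z, A y -> A z -> mdist y z <= t) -> diam A <= t.
Proof.
move=> t0 At; rewrite /diam; set S := [set _ | _ in _].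
have [->|/set0P S0] := eqVneq S set0; first by rewrite sup0.
by apply: ge_sup => // _ [[y z] [/= Ay Az] <-]; exact: At.
Qed.

Lemma diam_ge0 (A : set X) : 0 <= diam A.
Proof.
have [->|/set0P[y Ay]] := eqVneq A set0.
  by rewrite /diam set0X image_set0 sup0.
by rewrite -(mdistxx y); exact: mdist_le_diam.
Qed.

Lemma diam_ball_le (x : X) (r : R) : 0 <= r -> diam (ball x r) <= 2 * r.
Proof.
move=> r0; apply: diam_le => [|y z]; first by lra.
move=> /ball_mdist xy /ball_mdist xz.
by have := metric_triangle y x z; rewrite (metric_sym y x); lra.
Qed.

Lemma diam_le_bound (A : set X) : 0 <= M -> diam A <= M.
Proof. by move=> M0; apply: diam_le => // *; exact: ltW. Qed.

End metric.

(** * Hausdorff contents and measures as outer measures generated by balls *)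

Section hausdorff.
Context {R : realType} {X : metricType R}.
Variables (M : R) (M_bound : forall x y : X, mdist x y < M).
Variables (f : R -> R) (f0 : forall t, 0 <= t -> 0 <= f t).
Local Open Scope ereal_scope.
Implicit Types (eta : \bar R) (E F : set X).

Definition ball_cost eta (x : X) (r : R) : \bar R :=
  if (diam (ball x r))%:E <= eta then (f (diam (ball x r)))%:E else +oo.

Lemma ball_cost_ge0 eta (x : X) (r : R) : 0 <= ball_cost eta x r.
Proof.
rewrite /ball_cost; case: ifPn => // _.
by rewrite lee_fin; apply/f0/(diam_ge0 M_bound).
Qed.
Hint Resolve ball_cost_ge0 : core.

Lemma ball_cost_fin eta (x : X) (r : R) :
  ball_cost eta x r < +oo -> (diam (ball x r))%:E <= eta.
Proof. by rewrite /ball_cost; case: ifPn. Qed.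

Lemma hausdorff_content_etaE eta E :
  hausdorff_content_eta f eta E = ball_content (ball_cost eta) E.
Proof.
have cE (D : set nat) (x : nat -> X) r :
    (forall i, D i -> (diam (ball (x i) (r i)))%:E <= eta) ->
    \esum_(i in D) ball_cost eta (x i) (r i) =
    \esum_(i in D) (f (diam (ball (x i) (r i))))%:E.
  by move=> De; apply: eq_esum => i /De; rewrite /ball_cost => ->.
apply/eqP; rewrite eq_le; apply/andP; split; apply/ereal_infP.
  move=> _ [D [x [r [r0 ED ->]]]].
  have [Doo|] := ltP (\esum_(i in D) ball_cost eta (x i) (r i)) +oo; last first.
    by rewrite leye_eq => /eqP ->; rewrite leey.
  have De i : D i -> (diam (ball (x i) (r i)))%:E <= eta.
    move=> Di; apply: ball_cost_fin; apply: le_lt_trans Doo.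
    by apply: (esum_ge_term (a := fun i => ball_cost eta (x i) (r i))).
  apply: ereal_inf_lbound; exists D, x, r; split; last exact: cE.
  by split => // i Di; split; [exact: r0|exact: De].
move=> _ [D [x [r [[rD ED] ->]]]]; rewrite -cE => [|i /rD[]//].
by apply: ball_content_cover => // i /rD[].
Qed.

Lemma le_hausdorff_content_eta eta E F : E `<=` F ->
  hausdorff_content_eta f eta E <= hausdorff_content_eta f eta F.
Proof.
move=> EF; rewrite (hausdorff_content_etaE _ E) (hausdorff_content_etaE _ F).
exact: le_ball_content.
Qed.

Lemma hausdorff_content_eta_ge0 eta E : 0 <= hausdorff_content_eta f eta E.
Proof. by rewrite hausdorff_content_etaE; exact: ball_content_ge0. Qed.

Lemma hausdorff_content_eta_antitone eta eta' E : eta <= eta' ->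
  hausdorff_content_eta f eta' E <= hausdorff_content_eta f eta E.
Proof.
move=> ee'; apply/ereal_infP => _ [D [x [r [[rD ED] ->]]]].
apply: ereal_inf_lbound; exists D, x, r; split => //; split => // i /rD[-> re].
by rewrite (le_trans re).
Qed.

Lemma hausdorff_content_ball eta (x : X) (r : R) E : (0 < r)%R ->
  (diam (ball x r))%:E <= eta -> E `<=` ball x r ->
  hausdorff_content_eta f eta E <= (f (diam (ball x r)))%:E.
Proof.
move=> r0 re EB; rewrite hausdorff_content_etaE.
have := ball_content_ball (ball_cost_ge0 eta) r0 EB.
by rewrite /ball_cost re.
Qed.

(** A ball of diameter at most [eta < s] cannot meet two sets at distance at least [s]. *)
Lemma hausdorff_content_separated (s : R) eta (I : eqType) (e : rel I)
    (P : seq I) (E : I -> set X) F : eta < s%:E -> pairwise e P ->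
  (forall p q y z, e p q -> E p y -> E q z -> (s <= mdist y z)%R) ->
  (forall p, p \in P -> E p `<=` F) ->
  \sum_(p <- P) hausdorff_content_eta f eta (E p) <=
    hausdorff_content_eta f eta F.
Proof.
move=> es eP sep EF; rewrite hausdorff_content_etaE.
under eq_bigr do rewrite hausdorff_content_etaE.
apply: (ball_content_separated _ eP) => // p q x r epq /ball_cost_fin re.
move=> [y [Epy By]] [z [Eqz Bz]]; have := sep _ _ _ _ epq Epy Eqz.
apply/negP; rewrite -ltNge -lte_fin; apply: le_lt_trans es.
by apply: le_trans re; rewrite lee_fin; apply: (mdist_le_diam M_bound).
Qed.

(** Contents grow as [eta] decreases, so the limit defining the measure exists and is a supremum. *)
Let cvg_measure E : hausdorff_content_eta f eta%:E E @[eta --> 0%R^'+] -->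
  ereal_sup ((fun eta : R => hausdorff_content_eta f eta%:E E) @` `]0%R, +oo[).
Proof.
apply: (nonincreasing_at_right_cvge (BInfty R false)) => // s t _ _ st.
by apply: hausdorff_content_eta_antitone; rewrite lee_fin.
Qed.

Lemma hausdorff_content_le_measure (eta : R) E : (0 < eta)%R ->
  hausdorff_content_eta f eta%:E E <= hausdorff_measure f E.
Proof.
move=> eta0; rewrite /hausdorff_measure (cvg_lim _ (cvg_measure (E := E)))//.
by apply: ereal_sup_ubound; exists eta => //=; rewrite in_itv/= eta0.
Qed.

Lemma hausdorff_measure_le E t :
  (forall eta : R, (0 < eta)%R -> hausdorff_content_eta f eta%:E E <= t) ->
  hausdorff_measure f E <= t.
Proof.
move=> Et; rewrite /hausdorff_measure (cvg_lim _ (cvg_measure (E := E)))//.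
by apply: ge_ereal_sup => _ [eta /= + <-]; rewrite in_itv/= andbT; exact: Et.
Qed.

Lemma le_hausdorff_measure E F : E `<=` F ->
  hausdorff_measure f E <= hausdorff_measure f F.
Proof.
move=> EF; apply: hausdorff_measure_le => eta eta0.
exact: le_trans (le_hausdorff_content_eta _ EF) (hausdorff_content_le_measure _ eta0).
Qed.

Lemma hausdorff_measure_ge0 E : 0 <= hausdorff_measure f E.
Proof.
exact: le_trans (hausdorff_content_eta_ge0 1%:E _)
  (hausdorff_content_le_measure _ ltr01).
Qed.

Lemma hausdorff_measure_sigma_subadditive (G : nat -> set X) E :
  E `<=` \bigcup_n G n -> hausdorff_measure f E <= \sum_(n <oo) hausdorff_measure f (G n).
Proof.
move=> EG; apply: hausdorff_measure_le => eta eta0.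
rewrite hausdorff_content_etaE.
apply: le_trans (ball_content_sigma_subadditive (ball_cost_ge0 _) EG) _.
apply: lee_nneseries => n _; first by move=> _; exact: ball_content_ge0.
by rewrite -hausdorff_content_etaE; exact: hausdorff_content_le_measure.
Qed.

Lemma hausdorff_measure_bigcup (x0 : X) (I : set nat) (G : nat -> set X) E :
  E `<=` \bigcup_(i in I) G i ->
  hausdorff_measure f E <= \esum_(i in I) hausdorff_measure f (G i).
Proof.
move=> EI; pose H i := if i \in I then G i else set0.
have EH : E `<=` \bigcup_n H n.
  by move=> y /EI[i Ii Gi]; exists i => //; rewrite /H mem_set.
apply: (le_trans (hausdorff_measure_sigma_subadditive EH)).
rewrite nneseries_esumT; last by move=> n; exact: hausdorff_measure_ge0.
rewrite [leRHS]esum_mkcond; apply: le_esum => i _; rewrite /H.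
case: ifPn => // _; apply: hausdorff_measure_le => eta eta0.
by rewrite hausdorff_content_etaE (ball_content_set0 _ x0).
Qed.

Lemma hausdorff_measure_seq (x0 : X) (I : eqType) (P : seq I) (G : I -> set X) E :
  (forall y, E y -> exists2 p, p \in P & G p y) ->
  hausdorff_measure f E <= \sum_(p <- P) hausdorff_measure f (G p).
Proof.
move=> EG; apply: hausdorff_measure_le => eta eta0.
rewrite hausdorff_content_etaE.
apply: le_trans (ball_content_seq (ball_cost_ge0 _) x0 EG) _.
apply: lee_sum => p _.
by rewrite -hausdorff_content_etaE; exact: hausdorff_content_le_measure.
Qed.

(** With subadditivity, this is the metric outer measure property of Caratheodory. *)
Lemma hausdorff_measure_separated (s : R) E1 E2 F : (0 < s)%R ->
  (forall y z, E1 y -> E2 z -> (s <= mdist y z)%R) ->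
  E1 `<=` F -> E2 `<=` F ->
  hausdorff_measure f E1 + hausdorff_measure f E2 <= hausdorff_measure f F.
Proof.
move=> s0 sep E1F E2F.
(* Independent scales [a] and [b] let the two suprema be taken one after the other; below both
   scales and [s], the contents of the separated sets add up. *)
have H (a b : R) : (0 < a)%R -> (0 < b)%R ->
    hausdorff_content_eta f a%:E E1 + hausdorff_content_eta f b%:E E2 <=
    hausdorff_measure f F.
  move=> a0 b0; pose eta := Num.min (s / 2)%R (Num.min a b).
  have eta0 : (0 < eta)%R by rewrite !lt_min divr_gt0//= a0.
  have [es ea eb] : [/\ eta < s, eta <= a & eta <= b]%R.
    rewrite /eta !ge_min !lexx !orbT; split=> //.
    by rewrite (@le_lt_trans _ _ (s / 2)%R) ?ge_min ?lexx//; lra.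
  apply: le_trans (hausdorff_content_le_measure _ eta0).
  have := @hausdorff_content_separated s eta%:E bool (fun p q => p && ~~ q)
    [:: true; false] (fun p : bool => if p then E1 else E2) F.
  rewrite lte_fin es !big_cons big_nil adde0 => /(_ isT isT) h.
  apply: le_trans (h _ _); last 2 first.
  - by move=> [] [] //= y z _; exact: sep.
  - by move=> [].
  by apply: leeD; apply: hausdorff_content_eta_antitone; rewrite lee_fin.
have [Foo|] := ltP (hausdorff_measure f F) +oo; last first.
  by rewrite leye_eq => /eqP ->; rewrite leey.
have fin E : E `<=` F -> hausdorff_measure f E \is a fin_num.
  move=> EF; rewrite ge0_fin_numE ?hausdorff_measure_ge0//.
  exact: le_lt_trans (le_hausdorff_measure EF) Foo.
rewrite -leeBrDr ?fin//; apply: hausdorff_measure_le => a a0.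
have finc : hausdorff_content_eta f a%:E E1 \is a fin_num.
  rewrite ge0_fin_numE ?hausdorff_content_eta_ge0//.
  by rewrite (le_lt_trans (hausdorff_content_le_measure _ a0))//
    -ge0_fin_numE ?hausdorff_measure_ge0// fin.
rewrite leeBrDr ?fin// addeC -leeBrDr//; apply: hausdorff_measure_le => b b0.
by rewrite leeBrDr// addeC; exact: H.
Qed.

End hausdorff.

(** * Intersections of open sets of large content *)

Lemma sum_EFin_const (R : realType) (T : Type) (P : seq T) (t : R) :
  (\sum_(p <- P) t%:E)%E = (t * (size P)%:R)%:E.
Proof.
elim: P => [|p P IH]; first by rewrite big_nil mulr0.
by rewrite big_cons IH -EFinD /= -[(size P).+1]addn1 natrD mulrDr mulr1 addrC.
Qed.

Section large_intersection.
Context {R : realType} {X : metricType R}.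
Hypothesis X_compact : compact [set: X].
Variables (F : R -> R) (L : R).
Hypotheses (F_ge0 : forall t, 0 <= F t) (F_gt0 : forall t, 0 < t -> 0 < F t).
Hypothesis F_dbl : forall t, 0 < t -> F (2 * t) <= L * F t.
Hypothesis L_gt0 : 0 < L.

(** Charging the radius rather than the diameter makes the cost independent of the centre and lets
    doubling act directly on enlarged balls. *)
Definition radius_content : set X -> \bar R :=
  ball_content (fun (_ : X) r => (F r)%:E).

Let cost_ge0 (x : X) (r : R) : (0 <= (F r)%:E)%E.
Proof. by rewrite lee_fin. Qed.

Lemma iter_doubling n t : 0 < t -> F (2 ^+ n * t) <= L ^+ n * F t.
Proof.
move=> t0; elim: n => [|n IH]; first by rewrite !expr0 !mul1r.
rewrite !exprS -!mulrA (le_trans (F_dbl _)) ?mulr_gt0 ?exprn_gt0//.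
by rewrite ler_wpM2l// ltW.
Qed.

Lemma finite_avoid (D : set nat) (x : nat -> X) (K : set X) N :
  (forall i, D i -> exists2 s, 0 < s & forall y, K y -> s <= mdist y (x i)) ->
  exists2 s, 0 < s &
    forall i y, D i -> (i < N)%N -> K y -> s <= mdist y (x i).
Proof.
move=> DK; elim: N => [|N [s s0 IH]]; first by exists 1.
have [DN|nDN] := pselect (D N); last first.
  exists s => // i y Di; rewrite ltnS leq_eqVlt => /orP[/eqP iN|iN]; last exact: IH.
  by exfalso; apply: nDN; rewrite -iN.
have [t t0 Kt] := DK N DN; exists (Num.min s t); first by rewrite lt_min s0.
move=> i y Di; rewrite ltnS leq_eqVlt ge_min => /orP[/eqP ->|iN] Ky.
  by rewrite Kt// orbT.
by rewrite IH.
Qed.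

(* Every point of K sees mass [theta * F rho] in its [2 rho]-ball, but K keeps
   away from the first N atoms: at small scales only the tail of the series is
   seen, by disjoint balls, so few balls are needed to cover K. *)
Lemma radius_content_null (D : set nat) (x : nat -> X) (a : nat -> \bar R)
    (K : set X) (theta rho0 : R) :
  (forall i, 0 <= a i)%E -> (\esum_(i in D) a i < +oo)%E ->
  (forall i, D i -> exists2 s, 0 < s & forall y, K y -> s <= mdist y (x i)) ->
  0 < theta -> 0 < rho0 ->
  (forall y rho, K y -> 0 < rho -> rho < rho0 -> ((theta * F rho)%:E <=
     \esum_(i in D `&` [set i | mdist y (x i) < 2 * rho]%R) a i)%E) ->
  radius_content K = 0%E.
Proof.
move=> a0 Doo DK theta0 rho00 HK; apply/eqP; rewrite eq_le ball_content_ge0// andbT.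
apply/lee_addgt0Pr => e e0; rewrite add0e.
(* A covering ball of radius [8 * rho] costs at most [L ^+ 3 * F rho], while its centre sees mass
   [theta * F rho]: [k] is the ratio of the two. *)
pose k := L ^+ 3 / theta; have k0 : 0 < k by rewrite divr_gt0// exprn_gt0.
have [N HN] := esum_tail_lt a0 Doo (divr_gt0 e0 k0).
have [s s0 Hs] := finite_avoid N DK.
pose rho := Num.min rho0 s / 2.
have rho_gt0 : 0 < rho by rewrite divr_gt0// lt_min rho00.
have [rho_lt rho_s] : rho < rho0 /\ 2 * rho <= s.
  have : Num.min rho0 s <= rho0 by rewrite ge_min lexx.
  have : Num.min rho0 s <= s by rewrite ge_min lexx orbT.
  by rewrite /rho; split; lra.
have rho4 : 0 < 4 * rho by rewrite mulr_gt0.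
have [P [sepP PK KP]] := separated_net X_compact K rho4.
have cover : (radius_content K <= \sum_(p <- P) (F (2 * (4 * rho)))%:E)%E.
  apply: (le_trans (ball_content_seq cost_ge0 (x 0%N) KP)).
  apply: lee_sum => p _; apply: (ball_content_ball cost_ge0 (x := p)) => //.
  by rewrite mulr_gt0.
apply: (le_trans cover).
have mass : (\sum_(p <- P) (theta * F rho)%:E <= (e / k)%:E)%E.
  apply: le_trans (ltW HN).
  pose S p := D `&` [set i | (N <= i)%N] `&` [set i | mdist p (x i) < 2 * rho].
  apply: (@le_trans _ _ (\sum_(p <- P) \esum_(i in S p) a i)%E).
    rewrite big_seq [leRHS]big_seq; apply: lee_sum => p pP.
    apply: (le_trans (HK p rho (PK p pP) rho_gt0 rho_lt)).
    apply: esum_subset => // i [Di pi]; split => //; split => //=.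
    rewrite leqNgt; apply/negP => iN; have := Hs i p Di iN (PK p pP).
    by move: pi => /=; lra.
  apply: (sum_esum_le _ _ sepP) => //; last by move=> p _ i [].
  move=> p q pq; apply/disj_setPS => i [[_ /= pi] [_ /= qi]].
  have := metric_triangle p (x i) q; rewrite (metric_sym (x i) q); lra.
apply: (@le_trans _ _ (k%:E * \sum_(p <- P) (theta * F rho)%:E)%E); last first.
  rewrite -(_ : (k%:E * (e / k)%:E)%E = e%:E); last first.
    by rewrite -EFinM mulrCA divff ?mulr1// gt_eqF.
  by apply: lee_wpmul2l => //; rewrite lee_fin ltW.
rewrite ge0_sume_distrr; last by move=> *; rewrite lee_fin mulr_ge0// ltW.
apply: lee_sum => p _; rewrite -EFinM lee_fin /k.
rewrite (_ : 2 * (4 * rho) = 2 ^+ 3 * rho); last by ring.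
rewrite (le_trans (iter_doubling _ rho_gt0))//.
by rewrite mulrA divfK// gt_eqF.
Qed.

(** The fourfold enlarged balls have content at most half that of [U] in the ball of radius [s / 4],
    and the points where the last condition fails form a null set, so a point is left. In the bound
    on the cost, [L ^+ 4] pays [L ^+ 2] for the enlargement and [L ^+ 2] for passing from [s] to
    [s / 4]. *)
Lemma good_point (U : set X) (y : X) (s c : R) (D : set nat) (x : nat -> X)
    (r : nat -> R) (theta : R) :
  0 < s -> 0 < c -> 0 < theta -> (forall i, D i -> 0 < r i) ->
  ((c * F (s / 4))%:E <= radius_content (U `&` ball y (s / 4)))%E ->
  (\esum_(i in D) (F (r i))%:E <= (c / (2 * L ^+ 4) * F s)%:E)%E ->
  exists z, [/\ U z, mdist y z < s / 4, forall i, D i -> 4 * r i <= mdist z (x i)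
    & forall e, 0 < e -> exists t, [/\ 0 < t, t < e &
       (\esum_(i in D `&` [set i | mdist z (x i) < 2 * t]%R) (F (r i))%:E <=
         (theta * F t)%:E)%E]].
Proof.
move=> s0 c0 theta0 r0 cU cD.
have Doo : (\esum_(i in D) (F (r i))%:E < +oo)%E by rewrite (le_lt_trans cD)// ltry.
pose W := \bigcup_(i in D) ball (x i) (4 * r i).
(* Staying outside the enlarged balls keeps [bad k] at a positive distance from each centre [x i],
   as [radius_content_null] requires. *)
pose bad k : set X := [set z | (forall i, D i -> 4 * r i <= mdist z (x i)) /\
  forall t, 0 < t -> t < k.+1%:R^-1 ->
    ((theta * F t)%:E <=
     \esum_(i in D `&` [set i | mdist z (x i) < 2 * t]%R) (F (r i))%:E)%E].
have bad0 k : radius_content (bad k) = 0%E.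
  apply: (@radius_content_null D x (fun i => (F (r i))%:E) _ theta k.+1%:R^-1) => //.
  - by move=> i; rewrite lee_fin.
  - move=> i Di; exists (4 * r i); first by rewrite mulr_gt0// r0.
    by move=> z [+ _]; exact.
  - by move=> z t [_ +] t0 tk; exact.
have W_le : (radius_content W <= (c / 2 * F (s / 4))%:E)%E.
  apply: (@le_trans _ _ (\esum_(i in D) (F (4 * r i))%:E)%E).
    apply: (@ball_content_cover _ _ _ D x (fun i => 4 * r i)) => // i /r0 ri.
    by rewrite mulr_gt0.
  apply: (@le_trans _ _ (\esum_(i in D) ((L ^+ 2)%:E * (F (r i))%:E))%E).
    apply: le_esum => i /r0 ri; rewrite -EFinM lee_fin.
    by rewrite (_ : 4 = 2 ^+ 2); [exact: iter_doubling|ring].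
  apply: le_trans (esum_scale_le _ _ _) _.
  - by move=> i; rewrite lee_fin.
  - by rewrite exprn_ge0// ltW.
  apply: (@le_trans _ _ ((L ^+ 2)%:E * (c / (2 * L ^+ 4) * F s)%:E)%E).
    by apply: lee_wpmul2l => //; rewrite lee_fin exprn_ge0// ltW.
  rewrite -EFinM lee_fin.
  have -> : L ^+ 2 * (c / (2 * L ^+ 4) * F s) = c / (2 * L ^+ 2) * F s.
    by field; rewrite gt_eqF.
  apply: (@le_trans _ _ (c / (2 * L ^+ 2) * (L ^+ 2 * F (s / 4)))).
    rewrite ler_wpM2l//; first by rewrite divr_ge0 ?mulr_ge0 ?exprn_ge0// ltW.
    have s40 : 0 < s / 4 by rewrite divr_gt0.
    by have := iter_doubling 2 s40; congr (F _ <= _); field.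
  by rewrite le_eqVlt; apply/orP; left; apply/eqP; field; rewrite gt_eqF.
apply: contrapT => none.
have : U `&` ball y (s / 4) `<=` W `|` \bigcup_k bad k.
  move=> z [Uz /ball_mdist yz]; have [Wz|nWz] := pselect (W z); first by left.
  right; apply: contrapT => nbad; apply: none; exists z.
  have far i : D i -> 4 * r i <= mdist z (x i).
    move=> Di; rewrite leNgt; apply/negP => zi; apply: nWz; exists i => //.
    by apply/ball_mdist; rewrite metric_sym.
  split => // e e0; have [k] := ltr_add_invr e0; rewrite add0r => ke.
  apply: contrapT => H; apply: nbad; exists k => //; split => // t t0 tk.
  rewrite leNgt; apply/negP => /ltW ht; apply: H; exists t; split => //.
  exact: lt_trans ke.
move=> /(ball_contentU cost_ge0 y); rewrite -/radius_content => Ule.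
have badU : (radius_content (\bigcup_k bad k) <= 0)%E.
  apply: le_trans (ball_content_sigma_subadditive cost_ge0 (@subset_refl _ _)) _.
  by rewrite eseries0// => k _ _; exact: bad0.
have := le_trans cU (le_trans Ule (leeD W_le badU)).
rewrite adde0 lee_fin; have := mulr_gt0 c0 (F_gt0 (divr_gt0 s0 (ltr0n _ 4))); lra.
Qed.

(** Invariant of the nested construction, for the ball with centre [q.1] and radius [q.2]. The mass
    is measured at radius [2 * q.2] because a smaller ball that meets this one has its centre within
    that distance. *)
Let ball_in (D : set nat) (x : nat -> X) (r : nat -> R) (theta : R) (q : X * R) :=
  [/\ 0 < q.2, forall i, D i -> mdist q.1 (x i) < q.2 + r i -> r i < q.2 &
    (\esum_(i in D `&` [set i | mdist q.1 (x i) < 2 * q.2]%R) (F (r i))%:E <=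
      (theta * F q.2)%:E)%E].

(** [good_point] is applied to the balls centred within [2 * q.2] of [q.1]. The new threshold
    [theta] is arbitrary, since around a good point the cost is negligible along some scales tending
    to 0. *)
Let next_ball (U : set X) (D : set nat) (x : nat -> X) (r : nat -> R)
    (c theta : R) (q : X * R) : open U -> 0 < c -> 0 < theta ->
  (forall i, D i -> 0 < r i) ->
  (forall z t, 0 < t -> ((c * F t)%:E <= radius_content (U `&` ball z t))%E) ->
  ball_in D x r (c / (2 * L ^+ 4)) q ->
  exists q', [/\ ball_in D x r theta q', mdist q.1 q'.1 < q.2 / 4,
    q'.2 <= q.2 / 4 & ball q'.1 q'.2 `<=` U].
Proof.
move: q => [y s] oU c0 theta0 r0 cU [/= s0 big mass].
have s40 : 0 < s / 4 by rewrite divr_gt0.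
have r0' i : (D `&` [set i | mdist y (x i) < 2 * s]) i -> 0 < r i by case=> /r0.
have [z [Uz yz far Hz]] :=
  @good_point U y s c _ x r theta s0 c0 theta0 r0' (cU y _ s40) mass.
have /nbhs_ballP[d /= d0 dU] : nbhs z U by apply: open_nbhs_nbhs.
have [|t [t0 te Ht]] := Hz (Num.min (s / 4) d); first by rewrite lt_min s40.
have [ts td] : t < s / 4 /\ t < d by move: te; rewrite lt_min => /andP.
exists (z, t); split=> //=; last 2 first.
- exact: ltW.
- by apply: subset_trans dU; apply: le_ball; exact: ltW.
split=> //= [i Di zi|].
  (* A ball centred near [y] satisfies [4 * r i <= mdist z (x i) < t + r i], so it is smaller than
     [t]. One centred farther away cannot come this close: [big] would give [r i < s], hence a
     centre within [2 * s]. *)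
  have [yi|yi] := ltP (mdist y (x i)) (2 * s).
    by have := far i (conj Di yi); lra.
  have := metric_triangle y z (x i).
  have [/(big i Di)|] := ltP (mdist y (x i)) (s + r i); lra.
apply: le_trans Ht; apply: esum_subset; first by move=> i; rewrite lee_fin.
move=> i [Di /= zi]; split => //.
split => //=; have := metric_triangle y z (x i); lra.
Qed.

Lemma radius_content_bigcap (U : nat -> set X) (c : nat -> R) (c0 : R) :
  (forall n, open (U n)) -> (forall n, 0 < c n) -> 0 < c0 ->
  (forall x r, 0 < r -> ((c0 * F r)%:E <= radius_content (ball x r))%E) ->
  (forall n x r, 0 < r ->
     ((c n * F r)%:E <= radius_content (U n `&` ball x r))%E) ->
  forall x r, 0 < r -> ((c0 / (2 * L ^+ 4) * F r)%:E <=
    radius_content ((\bigcap_n U n) `&` ball x r))%E.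
Proof.
move=> oU cgt0 c00 Hc0 HU x0 r0 r00; rewrite leNgt; apply/negP.
move=> /ball_content_lt[D [x [r [rD UD cD]]]].
pose theta n := c n / (2 * L ^+ 4).
have theta0 n : 0 < theta n by rewrite divr_gt0// mulr_gt0// exprn_gt0.
(* The first ball is found with the whole space in place of an open set. Only [c0] is compared with
   the cost of the cover; [c 0] enters through the free threshold [theta 0], so the final constant
   does not depend on [c]. *)
have [q0 [q0in q0x q0r]] : exists q : X * R, [/\ ball_in D x r (theta 0%N) q,
    mdist x0 q.1 < r0 / 4 & q.2 < r0 / 4].
  have r40 : 0 < r0 / 4 by rewrite divr_gt0.
  have := @good_point setT x0 r0 c0 D x r (theta 0%N) r00 c00 (theta0 _) rD.
  rewrite setTI => /(_ (Hc0 _ _ r40) (ltW cD))[z [_ xz far Hz]].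
  have [t [t0 tr Ht]] := Hz _ r40; exists (z, t); split => //.
  by split => //= i Di; have := far i Di; have := rD i Di; lra.
have step (n : nat) (q : X * R) : exists q', ball_in D x r (theta n) q ->
    [/\ ball_in D x r (theta n.+1) q', mdist q.1 q'.1 < q.2 / 4,
        q'.2 <= q.2 / 4 & ball q'.1 q'.2 `<=` U n].
  have [qin|] := pselect (ball_in D x r (theta n) q); last by exists q.
  have [q' Hq'] := next_ball (oU n) (cgt0 n) (theta0 n.+1) rD (HU n) qin.
  by exists q'.
pose g n := projT1 (choice (step n)).
have Hg n : forall q, ball_in D x r (theta n) q -> [/\ ball_in D x r (theta n.+1) (g n q),
    mdist q.1 (g n q).1 < q.2 / 4, (g n q).2 <= q.2 / 4 &
    ball (g n q).1 (g n q).2 `<=` U n] := projT2 (choice (step n)).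
pose q := fix q n := if n is m.+1 then g m (q m) else q0.
have qin n : ball_in D x r (theta n) (q n).
  by elim: n => // n IH; have [] := Hg n _ IH.
have s_gt0 n : 0 < (q n).2 by case: (qin n).
(* Centres move by less than a quarter of the radius and radii shrink at least fourfold, so the
   balls of half radius are nested. The slack keeps the limit point inside the open balls of full
   radius. *)
have nest n : ball (q n.+1).1 ((q n.+1).2 / 2) `<=` ball (q n).1 ((q n).2 / 2).
  have [_ /= d1 d2 _] := Hg n _ (qin n); move=> z /ball_mdist z1; apply/ball_mdist.
  have := metric_triangle (q n).1 (g n (q n)).1 z; move: z1 => /=.
  by have := s_gt0 n; lra.
have nest_in n m : ball (q n).1 ((q n).2 / 2) (q (n + m)%N).1.
  suff : ball (q (n + m)%N).1 ((q (n + m)%N).2 / 2) `<=` ball (q n).1 ((q n).2 / 2).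
    by apply; apply: ballxx; rewrite divr_gt0.
  elim: m => [|m IH]; first by rewrite addn0.
  by rewrite addnS; apply: subset_trans IH.
have [z [_ zcl]] := X_compact (F := (fun n => (q n).1) @ \oo) _ filterT.
have zin n : mdist (q n).1 z < (q n).2.
  have h : 0 < (q n).2 / 2 by rewrite divr_gt0.
  have [||_ [[m /= nm <-] /ball_mdist zm]] :=
      zcl [set (q m).1 | m in [set m | (n <= m)%N]] (ball z ((q n).2 / 2)).
  - by exists n => // m nm; exists m.
  - exact: nbhsx_ballx.
  have := nest_in n (m - n)%N; rewrite subnKC// => /ball_mdist nq.
  have := metric_triangle (q n).1 (q m).1 z; rewrite (metric_sym (q m).1 z); lra.
have Uz : (\bigcap_n U n `&` ball x0 r0) z.
  split=> [n _|].
    have [_ _ _ + ] := Hg n _ (qin n); apply; apply/ball_mdist; exact: (zin n.+1).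
  apply/ball_mdist; have := zin 0%N; have := metric_triangle x0 q0.1 z.
  by rewrite /=; lra.
have [i Di /ball_mdist iz] := UD _ Uz; have ri := rD i Di.
have s_small n : (q n).2 * n.+1%:R <= q0.2.
  elim: n => [|n]; first by rewrite mulr1.
  apply: le_trans; have [_ _ + _] := Hg n _ (qin n).
  have := ltr0Sn R n; have := s_gt0 n; rewrite -[in n.+2%:R]addn1 natrD.
  have : 1 <= n.+1%:R :> R by rewrite ler1n.
  by rewrite /=; nra.
(* Take [n] with radius of [q n] below [r i]: the ball of index [i] contains [z], hence meets [q n],
   and the invariant would make it smaller than [q n]. *)
have [n] := ltr_add_invr (divr_gt0 ri (s_gt0 0%N)); rewrite add0r => nr.
have [_ /(_ i Di) + _] := qin n.
have := metric_triangle (q n).1 z (x i); rewrite (metric_sym z).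
have := zin n; move: nr; rewrite ltr_pdivlMr; last exact: (s_gt0 0%N).
rewrite mulrC ltr_pdivrMr// => nr nz tri /(_ _)/wrap[]; first by lra.
have := s_small n; have := s_gt0 n; rewrite /= in nr *.
have : 1 <= n.+1%:R :> R by rewrite ler1n.
by nra.
Qed.

End large_intersection.

(** * Ahlfors regular spaces *)

Section dimension_function.
Context {R : realType}.
Variables (f g : R -> R).
Hypotheses (f_dim : dimension_function f) (g_dim : dimension_function g).

Lemma dimension_function_ge0 t : 0 <= t -> 0 <= f t.
Proof. by case: f_dim => _ _ + _; exact. Qed.

Lemma dimension_function_le s t : 0 <= s -> s <= t -> f s <= f t.
Proof.
case: f_dim => _ f_homo _ _ s0 st.
by apply: f_homo => //; rewrite in_itv/= andbT// (le_trans s0).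
Qed.

(** A zero of [f] at [t] would make [f (2 * t)] negative, the doubling inequality being strict. *)
Lemma doubling_gt0 : doubling f -> forall t, 0 < t -> 0 < f t.
Proof.
move=> [D D1 fD] t t0; have := fD t t0.
have : 0 <= f (2 * t) by apply: dimension_function_ge0; rewrite mulr_ge0// ltW.
by have := dimension_function_ge0 (ltW t0); nra.
Qed.

Hypothesis (g_gt0 : forall t, 0 < t -> 0 < g t).

Lemma dim_prec_near0 : dim_prec f g ->
  exists2 q : R, 0 < q & exists2 e : R, 0 < e &
    forall t, 0 < t -> t < e -> q * g t < f t.
Proof.
move=> [_ [l l0 fl]].
have [q q0 ql] : exists2 q : R, 0 < q & (q%:E < l)%E.
  case: l l0 {fl} => [l|_|//]; last by exists 1; rewrite ?ltry.
  by rewrite lte_fin => l0; exists (l / 2); rewrite ?lte_fin; lra.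
have /fl : nbhs l [set y | (q%:E < y)%E].
  by apply: open_nbhs_nbhs; split => //; exact: open_ereal_gt_ereal.
rewrite /nbhs/= => -[e /= e0 He]; exists q => //; exists e => // t t0 te.
have /(_ _)/= := He t; rewrite /ball_/= sub0r normrN gtr0_norm// => /(_ te t0).
by rewrite lte_fin ltr_pdivlMr// g_gt0.
Qed.

(** Near 0, [f] exceeds a positive multiple of [g]; monotonicity carries positivity to larger
    arguments. *)
Lemma dim_prec_gt0 : dim_prec f g -> forall t, 0 < t -> 0 < f t.
Proof.
move=> /dim_prec_near0[q q0 [e e0 He]] t t0; pose s := Num.min t (e / 2).
have s0 : 0 < s by rewrite lt_min t0 divr_gt0.
have se : s < e by rewrite gt_min; apply/orP; right; lra.
have st : s <= t by rewrite ge_min lexx.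
apply: lt_le_trans (dimension_function_le (ltW s0) st).
by apply: lt_trans (He s s0 se); rewrite mulr_gt0// g_gt0.
Qed.

(* Whichever way f / g is monotone, it is almost decreasing on ]0, M]: if it is
   nondecreasing, then it is bounded away from 0 because of its limit at 0. *)
Lemma dim_prec_almost_decreasing (M : R) : 0 < M -> dim_prec f g ->
  exists2 K, 0 < K & forall s t, 0 < s -> s <= t -> t <= M ->
    f t * g s <= K * (f s * g t).
Proof.
move=> M0 fg; have f_gt0 := dim_prec_gt0 fg.
have [q q0 [e e0 He]] := dim_prec_near0 fg; case: fg => [[inc|dec] _].
(* A nondecreasing ratio lies between [q], its lower bound near 0, and its value at [M]; [K] is the
   quotient of these bounds. *)
- pose K := f M / g M / q.
  have K0 : 0 < K by rewrite !divr_gt0// ?f_gt0 ?g_gt0.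
  exists K => // s t s0 st tM; have t0 := lt_le_trans s0 st.
  have itv (u : R) : 0 < u -> u \in `]0, +oo[ by move=> u0; rewrite in_itv/= u0.
  have qs : q * g s <= f s.
    pose u := Num.min s (e / 2).
    have u0 : 0 < u by rewrite lt_min s0 divr_gt0.
    have ue : u < e by rewrite gt_min; apply/orP; right; lra.
    have us : u <= s by rewrite ge_min lexx.
    have /ltW := He u u0 ue; rewrite -ler_pdivlMr ?g_gt0// => qu.
    rewrite -ler_pdivlMr ?g_gt0//; apply: (le_trans qu).
    exact: (inc u s (itv _ u0) (itv _ s0) us).
  have := inc t M (itv _ t0) (itv _ M0) tM.
  rewrite ler_pdivrMr ?g_gt0// => tK.
  apply: (@le_trans _ _ (f M / g M * g t * g s)).
    by rewrite ler_wpM2r// ltW// g_gt0.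
  have -> : f M / g M * g t * g s = K * (q * g s * g t).
    by rewrite /K; field; rewrite !gt_eqF// g_gt0.
  by rewrite ler_wpM2l ?ler_wpM2r//; apply: ltW => //; exact: g_gt0.
- exists 1 => // s t s0 st _; have t0 := lt_le_trans s0 st.
  have := dec s t; rewrite !in_itv/= s0 t0 => /(_ isT isT st).
  by rewrite ler_pdivlMr ?g_gt0// mulrAC ler_pdivrMr ?g_gt0// mul1r.
Qed.

End dimension_function.

(** * Balls of a regular space and the capped dimension function *)

Section regular_space.
Context {R : realType} {X : metricType R}.
Variables (f g : R -> R) (M D K C : R).
Hypotheses (X_compact : compact [set: X]).
Hypotheses (f_dim : dimension_function f) (g_dim : dimension_function g).
Hypotheses (f_gt0 : forall t, 0 < t -> 0 < f t) (g_gt0 : forall t, 0 < t -> 0 < g t).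
Hypotheses (M_gt0 : 0 < M) (M_bound : forall x y : X, mdist x y < M).
Hypotheses (D_gt0 : 0 < D) (g_dbl : forall t, 0 < t -> g (2 * t) <= D * g t).
Hypothesis K_gt0 : 0 < K.
Hypothesis fg_decr :
  forall s t, 0 < s -> s <= t -> t <= M -> f t * g s <= K * (f s * g t).
Hypothesis C_gt0 : 0 < C.
Hypothesis g_reg : forall (x : X) r, 0 < r ->
  ((C^-1 * g r)%:E <= hausdorff_measure g (ball x r))%E /\
  (hausdorff_measure g (ball x r) <= (C * g r)%:E)%E.

(* All diameters are at most M, so capping does not change Hausdorff contents;
   the absolute value makes [capped] nonnegative on the whole line. *)
Definition capped (t : R) : R := f (Num.min `|t| M).

Let f_ge0 := dimension_function_ge0 f_dim.
Let g_ge0 := dimension_function_ge0 g_dim.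
Let L := K * D.

Lemma capped_ge0 t : 0 <= capped t.
Proof. by apply: f_ge0; rewrite le_min normr_ge0 ltW. Qed.

Lemma capped_gt0 t : 0 < t -> 0 < capped t.
Proof. by move=> t0; apply: f_gt0; rewrite lt_min normr_gt0 gt_eqF. Qed.

Lemma capped_le s t : 0 <= s -> s <= t -> capped s <= capped t.
Proof.
move=> s0 st; apply: (dimension_function_le f_dim).
  by rewrite le_min normr_ge0 ltW.
rewrite !ger0_norm ?(le_trans s0)// le_min !ge_min lexx orbT andbT st.
by [].
Qed.

Lemma cappedE t : 0 <= t -> t <= M -> capped t = f t.
Proof. by move=> t0 tM; rewrite /capped ger0_norm// min_l. Qed.

Lemma capped_bound t : M <= t -> capped t = f M.
Proof. by move=> Mt; rewrite /capped ger0_norm ?min_r// (le_trans (ltW M_gt0)). Qed.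

Lemma L_gt0 : 0 < L. Proof. exact: mulr_gt0. Qed.

(** Almost monotonicity of [f / g] transfers the doubling of [g] to [f], with constant [K * D]. *)
Lemma capped_doubling t : 0 < t -> capped (2 * t) <= L * capped t.
Proof.
have small s : 0 < s -> 2 * s <= M -> f (2 * s) <= L * f s.
  move=> s0 sM; have s_le : s <= 2 * s by lra.
  have := fg_decr s0 s_le sM.
  have := ler_wpM2l (ltW (mulr_gt0 K_gt0 (f_gt0 s0))) (g_dbl s0).
  have := g_gt0 s0; rewrite -(ler_pM2r (g_gt0 s0) (f (2 * s))) /L; lra.
move=> t0; have [tM|/ltW Mt] := leP (2 * t) M.
  by rewrite !cappedE; [exact: small|lra..].
(* Past the cap, [capped (2 * t)] is [f M], which is compared with [f (M / 2)], and [M / 2 <= t]. *)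
rewrite capped_bound//; have M20 : 0 < M / 2 by rewrite divr_gt0.
have := small _ M20; have -> : 2 * (M / 2) = M by field.
move=> /(_ (lexx _))/le_trans; apply; rewrite ler_pM2l ?L_gt0//.
rewrite -cappedE; [|lra..]; apply: capped_le; lra.
Qed.

(** A ball of diameter 0 would cover itself at cost [g 0 = 0] at every scale, against the lower
    bound of regularity. *)
Lemma diam_ball_gt0 (x : X) r : 0 < r -> 0 < diam (ball x r).
Proof.
move=> r0; rewrite lt_neqAle (diam_ge0 M_bound) andbT; apply/negP => /eqP d0.
have [+ _] := g_reg x r0; apply/negP; rewrite -ltNge.
apply: (@le_lt_trans _ _ 0%E); last first.
  by rewrite lte_fin mulr_gt0 ?invr_gt0// g_gt0.
apply: hausdorff_measure_le => // eta eta0.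
rewrite (le_trans (hausdorff_content_ball M_bound g_ge0 r0 _ (@subset_refl _ _)))//.
  by rewrite -d0 lee_fin ltW.
by rewrite -d0; case: g_dim => _ _ _ ->.
Qed.

Lemma ball_sub_diam (x : X) r : 0 < r -> ball x r `<=` ball x (2 * diam (ball x r)).
Proof.
move=> r0 y xy; apply/ball_mdist; have := diam_ball_gt0 x r0.
have := mdist_le_diam M_bound (ballxx x r0) xy; lra.
Qed.

(** * Comparison of radius contents with Hausdorff contents, and contents of balls *)

Local Notation RC := (@radius_content R X capped).

Let cost_ge0 (x : X) (r : R) : (0 <= (capped r)%:E)%E.
Proof. by rewrite lee_fin capped_ge0. Qed.

Lemma capped_diam (A : set X) : capped (diam A) = f (diam A).
Proof.
apply: cappedE; first exact: (diam_ge0 M_bound _).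
exact: (diam_le_bound M_bound _ (ltW M_gt0)).
Qed.

Lemma f_diam_ball_le (x : X) r : 0 < r -> f (diam (ball x r)) <= L * capped r.
Proof.
move=> r0; rewrite -capped_diam; apply: le_trans (capped_doubling r0).
by apply: capped_le (diam_ge0 M_bound _) (diam_ball_le x (ltW r0)).
Qed.

Lemma hausdorff_content_le_radius (E : set X) :
  (hausdorff_content f E <= L%:E * RC E)%E.
Proof.
rewrite /hausdorff_content (hausdorff_content_etaE M_bound f_ge0).
apply: ball_content_le_scale => //; first exact: (ball_cost_ge0 M_bound f_ge0 _).
  exact: L_gt0.
move=> x r r0; exists r => //; split=> //.
by rewrite /ball_cost leey -EFinM lee_fin; exact: f_diam_ball_le.
Qed.

(** The radius of a ball may far exceed its diameter, so each covering ball is first replaced by the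
    concentric ball of radius twice its diameter. *)
Lemma radius_content_le_hausdorff eta (E : set X) :
  (RC E <= L%:E * hausdorff_content_eta f eta E)%E.
Proof.
apply: (@le_trans _ _ (L%:E * hausdorff_content_eta f +oo%E E)%E); last first.
  apply: lee_wpmul2l; first by rewrite lee_fin ltW// L_gt0.
  by apply: hausdorff_content_eta_antitone; rewrite leey.
rewrite (hausdorff_content_etaE M_bound f_ge0).
apply: ball_content_le_scale => //; first exact: (ball_cost_ge0 M_bound f_ge0 _).
  exact: L_gt0.
move=> x r r0; have d0 := diam_ball_gt0 x r0.
exists (2 * diam (ball x r)); first by rewrite mulr_gt0.
split; first exact: ball_sub_diam.
rewrite /ball_cost leey -EFinM lee_fin -capped_diam.
exact: capped_doubling.
Qed.

Lemma hausdorff_measure_countable_balls (I : set nat) (x : nat -> X)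
    (r : nat -> R) (E : set X) :
  (forall i, I i -> 0 < r i) -> E `<=` \bigcup_(i in I) ball (x i) (r i) ->
  (hausdorff_measure g E <= \esum_(i in I) (C * g (r i))%:E)%E.
Proof.
move=> r0 EI; apply: (le_trans (hausdorff_measure_bigcup M_bound g_ge0 (x 0%N) EI)).
by apply: le_esum => i Ii; have [] := g_reg (x i) (r0 i Ii).
Qed.

(** Mass distribution principle with the measure of [g]. Either a covering ball has radius at least
    [r] and suffices alone, or all are smaller and [g (s i)] is at most [K * (g r / f r) * f (s i)],
    so the lower bound on the measure of the ball bounds the cost. The two cases give the two terms
    of [c]. *)
Lemma radius_content_ball_ge : exists2 c, 0 < c &
  forall x r, 0 < r -> ((c * capped r)%:E <= RC (ball x r))%E.
Proof.
pose c := Num.min 1 (C ^+ 2 * K)^-1.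
have CK0 : 0 < C ^+ 2 * K by rewrite mulr_gt0// exprn_gt0.
have c0 : 0 < c by rewrite lt_min ltr01 invr_gt0.
exists c => //.
suff main x r : 0 < r -> r <= M -> ((c * capped r)%:E <= RC (ball x r))%E.
  move=> x r r0; have [|/ltW Mr] := leP r M; first exact: main.
  rewrite capped_bound// -(capped_bound (lexx M)).
  apply: le_trans (main x M M_gt0 (lexx _)) _.
  by apply: le_ball_content; exact: le_ball.
move=> r0 rM; apply/ereal_infP => _ [I [y [s [s0 BI ->]]]].
have s_ge0 (i : nat) : (0 <= (capped (s i))%:E)%E by rewrite lee_fin capped_ge0.
have [[i Ii ri]|small] := pselect (exists2 i, I i & r <= s i).
  apply: le_trans (esum_ge_term s_ge0 Ii); rewrite lee_fin.
  apply: le_trans (capped_le (ltW r0) ri).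
  by rewrite ler_piMl ?capped_ge0// ge_min lexx.
have [+ _] := g_reg x r0 => /le_trans/(_ (hausdorff_measure_countable_balls s0 BI)).
pose k := C * K * (g r / f r).
have k0 : 0 < k by rewrite !mulr_gt0// ?invr_gt0 ?f_gt0 ?g_gt0.
have step : (\esum_(i in I) (C * g (s i))%:E <=
    k%:E * \esum_(i in I) (capped (s i))%:E)%E.
  apply: le_trans (esum_scale_le _ s_ge0 (ltW k0)).
  apply: le_esum => i Ii; rewrite -EFinM lee_fin.
  have si := s0 i Ii; have sr : s i <= r.
    by rewrite leNgt; apply/negP => /ltW rs; apply: small; exists i.
  rewrite cappedE ?(ltW si) ?(le_trans sr)//.
  rewrite -(ler_pM2r (f_gt0 r0)).
  have -> : k * f (s i) * f r = C * (K * (f (s i) * g r)).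
    by rewrite /k; field; rewrite gt_eqF ?f_gt0.
  by rewrite -mulrA ler_wpM2l ?(ltW C_gt0)// [g _ * _]mulrC fg_decr.
move=> /le_trans/(_ step); rewrite -lee_pdivrMl//; apply: le_trans.
rewrite -EFinM lee_fin cappedE ?(ltW r0)//.
have -> : k^-1 * (C^-1 * g r) = (C ^+ 2 * K)^-1 * f r.
  by rewrite /k; field; rewrite !gt_eqF// ?f_gt0 ?g_gt0.
by rewrite ler_wpM2r ?f_ge0 ?(ltW r0)// ge_min lexx orbT.
Qed.

Lemma radius_content_of_class A : large_intersection_class f A ->
  exists2 c, 0 < c & forall (x : X) r, 0 < r ->
    ((c * capped r)%:E <= RC (A `&` ball x r))%E.
Proof.
move=> [_ [c c0 cA]]; have [c' c'0 Hc'] := radius_content_ball_ge.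
exists (c * c' / L ^+ 2); first by rewrite divr_gt0 ?mulr_gt0 ?exprn_gt0 ?L_gt0.
move=> x r r0; have L0 := L_gt0.
have := le_trans (ltW (cA x r r0)) (hausdorff_content_le_radius (A `&` ball x r)).
rewrite -lee_pdivrMl//; apply: le_trans.
have := le_trans (Hc' x r r0) (radius_content_le_hausdorff +oo%E (ball x r)).
rewrite -lee_pdivrMl// => h.
apply: (@le_trans _ _ (L^-1%:E * (c%:E * (L^-1%:E * (c' * capped r)%:E)))%E).
  rewrite -!EFinM lee_fin le_eqVlt; apply/orP; left; apply/eqP; field.
  by rewrite gt_eqF.
rewrite lee_pmul2l ?lte_fin ?invr_gt0//.
by rewrite lee_pmul2l ?lte_fin.
Qed.

Lemma class_of_radius_content A c : Gdelta A -> 0 < c ->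
  (forall (x : X) r, 0 < r -> ((c * capped r)%:E <= RC (A `&` ball x r))%E) ->
  large_intersection_class f A.
Proof.
move=> GA c0 Hc; split => //; have L0 := L_gt0.
(* One [L] bounds the cost of a ball by its radius, the other compares the contents, and the 2 makes
   the inequality strict. *)
exists (c / (2 * L ^+ 2)); first by rewrite divr_gt0 ?mulr_gt0 ?exprn_gt0.
move=> x r r0; have F0 := capped_gt0 r0.
apply: (@le_lt_trans _ _ (c / (2 * L ^+ 2) * (L * capped r))%:E).
  rewrite [leRHS]EFinM lee_pmul2l//; last by rewrite lte_fin divr_gt0 ?mulr_gt0 ?exprn_gt0.
  have := hausdorff_content_ball M_bound f_ge0 r0 (leey _) (@subset_refl _ (ball x r)).
  by move=> /le_trans; apply; rewrite lee_fin f_diam_ball_le.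
have := le_trans (Hc x r r0) (radius_content_le_hausdorff +oo%E (A `&` ball x r)).
rewrite -lee_pdivrMl//; apply: lt_le_trans; rewrite -EFinM lte_fin.
have -> : c / (2 * L ^+ 2) * (L * capped r) = L^-1 * (c * capped r) / 2.
  by field; rewrite gt_eqF.
by rewrite ltr_pdivrMr// ltr_pMr ?mulr_gt0 ?invr_gt0// ltr1n.
Qed.

(** The open sets defining all the [A n] are listed as one sequence. Each contains some [A n] and
    inherits its constant, and [radius_content_bigcap] gives a bound free of these constants. *)
Lemma large_intersection_class_bigcap (A : nat -> set X) :
  (forall n, large_intersection_class f (A n)) ->
  large_intersection_class f (\bigcap_n A n).
Proof.
move=> HA; have [c0 c00 Hc0] := radius_content_ball_ge.
have /choice[c Hc] n : exists c, 0 < c /\ forall (x : X) r, 0 < r ->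
    ((c * capped r)%:E <= RC (A n `&` ball x r))%E.
  by have [c ? ?] := radius_content_of_class (HA n); exists c.
have /choice[U HU] n : exists U : nat -> set X,
    (forall i, open (U i)) /\ A n = \bigcap_i U i.
  by have [[U ? ?] _] := HA n; exists U.
(* An index that codes no pair repeats the set [U 0 0], which leaves the intersection unchanged. *)
pose dec (j : nat) : nat * nat := odflt (0%N, 0%N) (unpickle j).
pose V j := U (dec j).1 (dec j).2.
have AV : \bigcap_n A n = \bigcap_j V j.
  apply/seteqP; split => z Hz.
    by move=> j _; have := Hz (dec j).1 I; rewrite (HU (dec j).1).2; apply.
  move=> n _; rewrite (HU n).2 => i _; have := Hz (pickle (n, i)) I.
  by rewrite /V /dec pickleK.
have oV j : open (V j) by exact: (HU _).1.
apply: (@class_of_radius_content _ (c0 / (2 * L ^+ 4))).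
- by exists V.
- by rewrite divr_gt0// mulr_gt0// exprn_gt0// L_gt0.
rewrite AV; apply: (radius_content_bigcap X_compact capped_ge0 capped_gt0
  capped_doubling L_gt0 (c := fun j => c (dec j).1)) => //.
  by move=> j; exact: (Hc _).1.
move=> j x r r0; apply: le_trans ((Hc (dec j).1).2 x r r0) _.
apply: le_ball_content; apply: setSI; rewrite (HU (dec j).1).2.
exact: bigcap_inf.
Qed.

(** * Measures of sets of the class *)

Lemma hausdorff_measure_infinite (x0 : X) (A : set X) :
  large_intersection_class f A ->
  (forall Q, exists r, [/\ 0 < r, r <= M & Q * g r < f r]) ->
  hausdorff_measure f A = +oo%E.
Proof.
move=> /radius_content_of_class[c c0 Hc] ratio; have L0 := L_gt0.
(* The net has at least [g M / (C ^+ 2 * D ^+ 3 * g r)] points, by regularity at radii [M] and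
   [8 * r], and each carries content at least [c / L * f r]; the total is at least
   [k * (f r / g r)]. *)
pose k := c / L * (g M / (C ^+ 2 * D ^+ 3)).
have k0 : 0 < k by rewrite !(mulr_gt0, divr_gt0, exprn_gt0, invr_gt0)// g_gt0.
apply: eq_infty => y; have [r [r0 rM Qr]] := ratio (`|y| / k).
have r40 : 0 < 4 * r by rewrite mulr_gt0.
have [P [sepP _ XP]] := separated_net X_compact setT r40.
have count : C^-1 * g M <= C * (D ^+ 3 * g r) * (size P)%:R.
  rewrite -lee_fin; apply: le_trans (g_reg x0 M_gt0).1 _.
  apply: le_trans (hausdorff_measure_seq M_bound g_ge0 x0 (P := P)
    (G := fun p => ball p (2 * (4 * r))) _) _; first by move=> z _; exact: XP.
  rewrite -sum_EFin_const; apply: lee_sum => p _.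
  have r80 : 0 < 2 * (4 * r) by rewrite mulr_gt0.
  apply: le_trans (g_reg p r80).2 _; rewrite lee_fin ler_pM2l//.
  rewrite (_ : 2 * (4 * r) = 2 ^+ 3 * r); last by ring.
  exact: (iter_doubling g_dbl D_gt0).
apply: (@le_trans _ _ (L^-1 * (c * f r) * (size P)%:R)%:E); last first.
  apply: le_trans (hausdorff_content_le_measure _ _ r0).
  apply: le_trans (hausdorff_content_separated (s := 2 * r) M_bound f_ge0 _ sepP
    (E := fun p => A `&` ball p r) _ _).
  - rewrite -sum_EFin_const; apply: lee_sum => p _.
    rewrite EFinM lee_pdivrMl//; apply: le_trans (radius_content_le_hausdorff _ _).
    by rewrite -cappedE ?(ltW r0)//; exact: Hc.
  - by rewrite lte_fin; lra.
  - move=> p q z w pq [_ /ball_mdist pz] [_ /ball_mdist qw].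
    have := metric_triangle p z q; have := metric_triangle z w q.
    by rewrite (metric_sym w q); lra.
  - by move=> p _ z [].
rewrite lee_fin; apply: (le_trans (ler_norm y)).
have {}Qr := ltW Qr.
apply: (@le_trans _ _ (L^-1 * (c * (`|y| / k * g r)) * (size P)%:R)); last first.
  by rewrite ler_wpM2r// ler_wpM2l ?invr_ge0 ?(ltW L0)// ler_wpM2l ?(ltW c0).
have -> : L^-1 * (c * (`|y| / k * g r)) * (size P)%:R =
    `|y| * (C * (D ^+ 3 * g r) * (size P)%:R) / (C^-1 * g M).
  by rewrite /k; field; rewrite !gt_eqF// g_gt0.
rewrite ler_pdivlMr; last by rewrite mulr_gt0 ?invr_gt0// g_gt0.
by rewrite ler_wpM2l.
Qed.

(** * The complement of an open set containing a set of the class *)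

Section complement.
Variables (x0 : X) (V : set X).
Hypotheses (oV : open V) (f_fin : (hausdorff_measure f [set: X] < +oo)%E).

Let inner n : set X := [set y | forall z, ~ V z -> (2 ^+ n)^-1 <= mdist y z].
Let shell n := inner n.+1 `\` inner n.

Let inner_le m n : (m <= n)%N -> inner m `<=` inner n.
Proof.
move=> mn y ym z /ym; apply: le_trans.
by rewrite lef_pV2 ?posrE ?exprn_gt0// ler_weXn2l// ler1n.
Qed.

Let inner_cover y : V y -> exists n, inner n y.
Proof.
move=> Vy; have /nbhs_ballP[e /= e0 eV] : nbhs y V by apply: open_nbhs_nbhs.
have [n] := ltr_add_invr e0; rewrite add0r => ne; exists n => z nVz.
rewrite leNgt; apply/negP => yz; apply: nVz; apply: eV; apply/ball_mdist.
apply: (lt_trans yz); apply: le_lt_trans ne.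
rewrite lef_pV2 ?posrE ?exprn_gt0// -natrX ler_nat.
exact: ltn_expl.
Qed.

Let inner_separated n y z : inner n y -> ~ inner n.+1 z ->
  (2 ^+ n.+1)^-1 <= mdist y z.
Proof.
move=> ny /existsNP[w /not_implyP[nVw /negP]]; rewrite -ltNge => zw.
have := ny w nVw; have := metric_triangle y z w.
have -> : (2 ^+ n)^-1 = 2 * (2 ^+ n.+1)^-1 :> R.
  by rewrite exprS; field; rewrite expf_neq0.
lra.
Qed.

(** [inner m] and [shell m.+1] are separated subsets of [inner m.+2], so the induction trades
    [inner m] for [inner m.+2]. The two terms absorb the shells of either parity. *)
Let shell_sum m : (\sum_(0 <= n < m) hausdorff_measure f (shell n.+1) <=
  hausdorff_measure f (inner m) + hausdorff_measure f (inner m.+1))%E.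
Proof.
have H0 (E : set X) := hausdorff_measure_ge0 M_bound f_ge0 E.
elim: m => [|m IH]; first by rewrite big_geq// adde_ge0.
rewrite big_nat_recr//=.
apply: (le_trans (leeD IH (lexx _))); rewrite -addeA addeCA leeD2l//.
apply: (hausdorff_measure_separated M_bound f_ge0 (s := (2 ^+ m.+1)^-1)).
- by rewrite invr_gt0 exprn_gt0.
- by move=> y z ym [_ /inner_separated]; exact.
- by apply: inner_le; rewrite -addn2 leq_addr.
- by move=> y [].
Qed.

(* Distant shells around the complement of V are separated, so the sum of
   their measures is at most twice the total measure, and its tail vanishes. *)
Let collar_small e : 0 < e ->
  exists n, (hausdorff_measure f (V `\` inner n) <= e%:E)%E.
Proof.
move=> e0; pose a n := hausdorff_measure f (shell n.+1).
have a0 n : (0 <= a n)%E := hausdorff_measure_ge0 M_bound f_ge0 _.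
have aoo : (\esum_(n in [set: nat]) a n < +oo)%E.
  apply: (@le_lt_trans _ _ (hausdorff_measure f [set: X] + hausdorff_measure f [set: X])%E);
    last by rewrite lte_add_pinfty.
  rewrite -nneseries_esumT//; apply: lime_le; first exact: is_cvg_nneseries.
  apply: nearW => m; apply: (le_trans (shell_sum m)).
  by apply: leeD; exact: (le_hausdorff_measure M_bound f_ge0).
have [N HN] := esum_tail_lt a0 aoo e0; exists N.+1.
apply: le_trans (ltW HN).
apply: (hausdorff_measure_bigcup M_bound f_ge0 x0) => y [Vy ny].
have := inner_cover Vy; move=> [m ym].
(* The least index [m'] with [inner m' y] exceeds [N.+1]; written [k.+2], it places [y] in
   [shell k.+1] with [N <= k]. *)
have ex : exists m, `[< inner m y >] by exists m; apply/asboolP.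
case: (ex_minnP ex) => {ym} m' /asboolP ym' min.
have Nm : (N.+1 < m')%N by rewrite ltnNge; apply/negP => /inner_le/(_ _ ym').
case: m' ym' min Nm => [|[|k]]// yk min; rewrite !ltnS => Nk.
exists k => //; split => // yk1.
by have := min k.+1; rewrite ltnn => /(_ _)/wrap[]//; apply/asboolP.
Qed.

Lemma hausdorff_content_complement (A : set X) (eta : R) : 0 < eta ->
  A `<=` V -> large_intersection_class f A ->
  (hausdorff_content_eta f eta%:E (~` V) <= 0)%E.
Proof.
move=> eta0 AV /radius_content_of_class[c c0 Hc]; have L0 := L_gt0.
apply/lee_addgt0Pr => e e0; rewrite add0e.
(* A net point costs [L ^+ 4 * capped rho] to cover and carries content [L^-1 * c * capped rho]; the
   ratio is [L ^+ 5 / c]. *)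
have e'0 : 0 < e * (c / L ^+ 5) by rewrite mulr_gt0// divr_gt0// exprn_gt0.
have [n Hn] := collar_small e'0.
(* Covering balls of radius [8 * rho] have diameter at most [eta], and a ball of radius [rho]
   centred outside [V] does not meet [inner n]. *)
pose rho := Num.min (eta / 16) (2 ^+ n)^-1.
have rho0 : 0 < rho by rewrite lt_min divr_gt0//= invr_gt0 exprn_gt0.
have [rho_eta rho_n] : 16 * rho <= eta /\ rho <= (2 ^+ n)^-1.
  have : rho <= eta / 16 by rewrite ge_min lexx.
  have : rho <= (2 ^+ n)^-1 by rewrite ge_min lexx orbT.
  by move=> ? ?; split => //; lra.
have rho4 : 0 < 4 * rho by rewrite mulr_gt0.
have rho8 : 0 < 2 * (4 * rho) by rewrite mulr_gt0.
have [P [sepP PK KP]] := separated_net X_compact (~` V) rho4.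
have count : L^-1 * (c * capped rho) * (size P)%:R <= e * (c / L ^+ 5).
  rewrite -lee_fin; apply: le_trans Hn.
  apply: le_trans (hausdorff_content_le_measure _ _ rho0).
  rewrite -sum_EFin_const.
  apply: (@le_trans _ _ (\sum_(p <- P)
      hausdorff_content_eta f rho%:E (A `&` ball p rho))%E).
    apply: lee_sum => p _; rewrite EFinM lee_pdivrMl//.
    by apply: le_trans (radius_content_le_hausdorff _ _); exact: Hc.
  apply: (hausdorff_content_separated (s := 2 * rho) M_bound f_ge0 _ sepP).
  - by rewrite lte_fin; lra.
  - move=> p q z w pq [_ /ball_mdist pz] [_ /ball_mdist qw].
    have := metric_triangle p z q; have := metric_triangle z w q.
    by rewrite (metric_sym w q); lra.
  - move=> p pP z [Az /ball_mdist pz]; split; first exact: AV.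
    by move=> /(_ p (PK p pP)); rewrite metric_sym; lra.
apply: (@le_trans _ _ (L ^+ 4 * capped rho * (size P)%:R)%:E).
  rewrite -sum_EFin_const (hausdorff_content_etaE M_bound f_ge0).
  apply: le_trans (ball_content_seq (ball_cost_ge0 M_bound f_ge0 _) x0 KP) _.
  apply: lee_sum => p _.
  rewrite -(hausdorff_content_etaE M_bound f_ge0).
  apply: le_trans (hausdorff_content_ball M_bound f_ge0 rho8 _ (@subset_refl _ _)) _.
    rewrite lee_fin; apply: le_trans (diam_ball_le p (ltW rho8)) _.
    by apply: le_trans rho_eta; lra.
  rewrite lee_fin; apply: le_trans (f_diam_ball_le p rho8) _.
  rewrite exprS -mulrA ler_pM2l// (_ : 2 * (4 * rho) = 2 ^+ 3 * rho); last by ring.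
  exact: (iter_doubling capped_doubling L0).
rewrite lee_fin.
have -> : L ^+ 4 * capped rho * (size P)%:R =
    L^-1 * (c * capped rho) * (size P)%:R / (c / L ^+ 5).
  by field; rewrite !gt_eqF.
by rewrite ler_pdivrMr// divr_gt0// exprn_gt0.
Qed.

End complement.

(** The union [V] of any cover of [A] at scale [eta] is open, and its complement has content 0 at
    that scale, so the cost of the cover already bounds the content of the whole space. *)
Lemma hausdorff_measure_full (x0 : X) (A : set X) :
  large_intersection_class f A -> (hausdorff_measure f [set: X] < +oo)%E ->
  (hausdorff_measure f [set: X] <= hausdorff_measure f A)%E.
Proof.
move=> HA f_fin; apply: hausdorff_measure_le => eta eta0.
apply: le_trans (hausdorff_content_le_measure _ _ eta0).
rewrite (hausdorff_content_etaE M_bound f_ge0 _ A).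
apply/ereal_infP => _ [I [x [r [r0 AI ->]]]].
pose V := \bigcup_(i in I) ball (x i) (r i).
have oV : open V by apply: bigcup_open => i _; exact: open_metric_ball.
have cost0 := ball_cost_ge0 M_bound f_ge0 eta%:E.
rewrite (hausdorff_content_etaE M_bound f_ge0).
have TV : [set: X] `<=` V `|` ~` V by rewrite setUv.
apply: le_trans (ball_contentU cost0 x0 TV) _.
have := hausdorff_content_complement x0 oV f_fin eta0 AI HA.
rewrite (hausdorff_content_etaE M_bound f_ge0) => Vc0.
by rewrite -[leRHS]adde0; apply: leeD => //; exact: ball_content_cover.
Qed.

(** The space is a ball of radius [M], so its measure for [g] is at most [C * g M]. *)
Lemma hausdorff_measure_lty (x0 : X) (Q : R) : 0 < Q ->
  (forall t, 0 < t -> t <= M -> f t <= Q * g t) ->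
  (hausdorff_measure f [set: X] < +oo)%E.
Proof.
move=> Q0 fQ.
apply: (@le_lt_trans _ _ (Q%:E * (C * g M)%:E)%E); last by rewrite -EFinM ltry.
apply: hausdorff_measure_le => eta eta0.
apply: (@le_trans _ _ (Q%:E * hausdorff_content_eta g eta%:E [set: X])%E).
  rewrite (hausdorff_content_etaE M_bound f_ge0) (hausdorff_content_etaE M_bound g_ge0).
  apply: ball_content_le_scale => //.
  - exact: (ball_cost_ge0 M_bound f_ge0).
  - exact: (ball_cost_ge0 M_bound g_ge0).
  move=> x r r0; exists r => //; split => //; rewrite /ball_cost; case: ifPn => _.
    rewrite -EFinM lee_fin; apply: fQ; first exact: diam_ball_gt0.
    exact: (diam_le_bound M_bound _ (ltW M_gt0)).
  by rewrite gt0_muley// lte_fin.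
rewrite lee_pmul2l ?lte_fin//.
apply: le_trans (hausdorff_content_le_measure _ _ eta0) _.
apply: le_trans (g_reg x0 M_gt0).2; apply: (le_hausdorff_measure M_bound g_ge0) => y _.
exact/ball_mdist/M_bound.
Qed.

Lemma large_intersection_class_measure (x0 : X) (A : set X) :
  large_intersection_class f A ->
  hausdorff_measure f A = hausdorff_measure f [set: X].
Proof.
move=> HA; apply/eqP; rewrite eq_le (le_hausdorff_measure M_bound f_ge0)//=.
have [[Q HQ]|unbounded] := pselect (exists Q, forall t, 0 < t -> t <= M -> f t <= Q * g t).
  apply: hausdorff_measure_full => //.
  apply: (@hausdorff_measure_lty x0 (Num.max Q 1)); first by rewrite lt_max ltr01 orbT.
  move=> t t0 tM; apply: (le_trans (HQ t t0 tM)).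
  by rewrite ler_pM2r ?g_gt0// le_max lexx.
rewrite (hausdorff_measure_infinite x0 HA) ?leey// => Q.
apply: contrapT => no; apply: unbounded; exists Q => t t0 tM.
by rewrite leNgt; apply/negP => Qt; apply: no; exists t.
Qed.

End regular_space.

Theorem theorem2p5 (R : realType) (X : metricType R) (g f : R -> R)
    (X_compact : compact [set: X])
    (g_dim : dimension_function g) (g_doubling : doubling g)
    (X_regular : ahlfors_regular X g)
    (f_dim : dimension_function f) (f_prec_g : dim_prec f g) :
  (forall A : nat -> set X,
      (forall n, large_intersection_class f (A n)) ->
      large_intersection_class f (\bigcap_n A n)) /\
  (forall A : set X, large_intersection_class f A ->
      hausdorff_measure f A = hausdorff_measure f [set: X]).
Proof.
have g_gt0 := doubling_gt0 g_dim g_doubling.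
have f_gt0 := dim_prec_gt0 f_dim g_gt0 f_prec_g.
have [D D1 Dg] := g_doubling; have D0 := lt_trans ltr01 D1.
have g_dbl t (t0 : 0 < t) := ltW (Dg t t0).
have [C C0 g_reg] := X_regular.
have [M M0 M_bound] := compact_mdist_bounded X_compact.
have [K K0 fg] := dim_prec_almost_decreasing f_dim g_gt0 M0 f_prec_g.
split => [A|A HA].
  exact: (large_intersection_class_bigcap X_compact f_dim g_dim f_gt0 g_gt0 M0
    M_bound D0 g_dbl K0 fg C0 g_reg).
(* The measure lemmas need a base point; in an empty space all subsets coincide. *)
have [[x0 _]|X0] := pselect (exists x : X, True).
  exact: (large_intersection_class_measure X_compact f_dim g_dim f_gt0 g_gt0 M0
    M_bound D0 g_dbl K0 fg C0 g_reg x0).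
by congr hausdorff_measure; apply/seteqP; split => // x _; case: X0; exists x.
Qed.
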